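(* For $n\in\{4,5,6,7,8,9,10\}$ let $\psi(n)$ denote the number of switching non-isomorphic signed graphs with underlying graph the wheel $W_n$ (that is, the number of switching isomorphism classes of signed wheels on $W_n$). Then $$\psi(4)=6,\quad \psi(5)=8,\quad \psi(6)=13,\quad \psi(7)=18,\quad \psi(8)=30,\quad \psi(9)=46,\quad \psi(10)=78.$$
   Context: The wheel $W_n$ is the join of the cycle $C_n$ and a single vertex: $V(W_n)=\{v,v_1,\dots,v_n\}$ and $E(W_n)=\{vv_i,\ v_iv_{i+1} : 1\le i\le n\}$ with subscripts modulo $n$. A signed graph $\Sigma=(G,\sigma)$ is a graph $G$ together with a function $\sigma:E(G)\to\{+1,-1\}$. Switching $\Sigma$ at a vertex $u$ changes the sign of every edge incident to $u$. Two signed graphs are isomorphic if there is a graph isomorphism between their underlying graphs preserving edge signs. Two signed graphs are switching isomorphic if one is isomorphic to a signed graph obtained from the other by a sequence of switchings. *)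

(* Defs.v *)
From HB Require Import structures.
From mathcomp Require Import all_boot.

Set Implicit Arguments.
Unset Strict Implicit.
Unset Printing Implicit Defensive.

Record sgraph := SGraph {
  vertex :> finType;
  adj : rel vertex;
  adj_sym : symmetric adj;
  adj_irr : irreflexive adj }.

Definition edges (G : sgraph) : {set {set G}} :=
  [set [set x; y] | x in G, y in G & adj x y].

Definition edge (G : sgraph) := {e : {set G} | e \in edges G}.

(* The sign (-1)^b is encoded by b : bool, so that true stands for -1 and     *)
(* multiplication of signs is addb.                                           *)
Definition signature (G : sgraph) := {ffun edge G -> bool}.

Definition switch (G : sgraph) (u : G) (s : signature G) : signature G :=
  [ffun e : edge G => s e (+) (u \in val e)].

Definition switching_step (G : sgraph) : rel (signature G) :=
  fun s t => [exists u : G, t == switch u s].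

Definition switching_equivalent (G : sgraph) : rel (signature G) :=
  connect (@switching_step G).

Definition graph_iso (G H : sgraph) (f : {ffun G -> H}) : bool :=
  [&& injectiveb f, [forall y, y \in codom f]
    & [forall x, forall y, adj (f x) (f y) == adj x y]].

Definition signed_iso (G H : sgraph) (s : signature G) (t : signature H)
    : bool :=
  [exists f : {ffun G -> H}, graph_iso f &&
    [forall e : edge G, forall e' : edge H,
       (val e' == f @: val e) ==> (t e' == s e)]].

Definition switching_isomorphic (G H : sgraph)
    (s : signature G) (t : signature H) : bool :=
  [exists t' : signature H, switching_equivalent t t' && signed_iso s t'].

(* None is the hub v and Some i, with i : 'I_n, is the rim vertex v_(i+1);    *)
(* ordS is the successor modulo n. The condition i != j only matters for      *)
(* n = 1, where it discards a loop.                                           *)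
Definition wheel_adj n (x y : option 'I_n) : bool :=
  match x, y with
  | None, None => false
  | None, Some _ | Some _, None => true
  | Some i, Some j => (i != j) && ((j == ordS i) || (i == ordS j))
  end.

Lemma wheel_adj_sym n : symmetric (@wheel_adj n).
Proof. by move=> [i|] [j|] //=; rewrite eq_sym orbC. Qed.

Lemma wheel_adj_irr n : irreflexive (@wheel_adj n).
Proof. by move=> [i|] //=; rewrite eqxx. Qed.

Definition wheel n : sgraph := SGraph (@wheel_adj_sym n) (@wheel_adj_irr n).


Lemma switchK (G : sgraph) (u : G) : involutive (switch u).
Proof. by move=> s; apply/ffunP=> e; rewrite !ffunE addbK. Qed.

Lemma switching_equivalent_sym (G : sgraph) :
  symmetric (@switching_equivalent G).
Proof.
apply: sym_connect_sym => s t.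
by apply/existsP/existsP=> -[u /eqP->]; exists u; rewrite switchK.
Qed.

Lemma graph_isoP (G H : sgraph) (f : {ffun G -> H}) :
  reflect (bijective f /\ {mono f : x y / adj x y}) (graph_iso f).
Proof.
apply: (iffP and3P) => [[/injectiveP f_inj /forallP f_surj /forallP f_adj]|].
  split=> [|x y]; last by apply/eqP; move/forallP: (f_adj x); apply.
  exists (fun y => iinv (f_surj y)) => [x|y]; last exact: f_iinv.
  by apply: f_inj; rewrite f_iinv.
move=> [f_bij f_adj]; have [g fK gK] := f_bij; split.
- exact/injectiveP/(can_inj fK).
- by apply/forallP=> y; rewrite -[y]gK codom_f.
- by apply/forallP=> x; apply/forallP=> y; rewrite f_adj.
Qed.

Lemma signed_isoP (G H : sgraph) (s : signature G) (t : signature H) :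
  reflect (exists2 f : {ffun G -> H}, graph_iso f &
             forall (e : edge G) (e' : edge H),
               val e' = f @: val e -> t e' = s e)
          (signed_iso s t).
Proof.
apply: (iffP existsP) => -[f].
  case/andP=> f_iso /forallP f_sgn; exists f => // e e' /eqP e'E.
  by apply/eqP; move/forallP: (f_sgn e) => /(_ e') /implyP; apply.
move=> f_iso f_sgn; exists f; rewrite f_iso; apply/forallP=> e.
by apply/forallP=> e'; apply/implyP=> /eqP/f_sgn->.
Qed.

Lemma imset_edges (G H : sgraph) (f : {ffun G -> H}) (e : edge G) :
  graph_iso f -> f @: val e \in edges H.
Proof.
case/graph_isoP=> _ f_adj; case: e => e /= /imset2P[x y _].
rewrite inE => /andP[_ xy] ->; rewrite imsetU1 imset_set1.
by apply: imset2_f; rewrite ?inE ?f_adj.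
Qed.

Lemma signed_iso_refl (G : sgraph) (s : signature G) : signed_iso s s.
Proof.
apply/signed_isoP; exists [ffun x => x].
  apply/graph_isoP; split=> [|x y]; last by rewrite !ffunE.
  by exists id => x; rewrite ffunE.
move=> e e'; rewrite (eq_imset _ (ffunE _)) imset_id => e'E.
by congr (s _); apply: val_inj.
Qed.

Lemma signed_iso_sym (G H : sgraph) (s : signature G) (t : signature H) :
  signed_iso s t -> signed_iso t s.
Proof.
case/signed_isoP=> f /graph_isoP[[g fK gK] f_adj] f_sgn.
apply/signed_isoP; exists (finfun g).
  apply/graph_isoP; split=> [|x y]; last by rewrite !ffunE -f_adj !gK.
  by exists f => x; rewrite ffunE.
move=> e e' e'E; rewrite (f_sgn e') // e'E (eq_imset _ (ffunE _)).
by rewrite -imset_comp (eq_imset (g := id)) ?imset_id.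
Qed.

Lemma signed_iso_trans (G H K : sgraph)
    (s : signature G) (t : signature H) (r : signature K) :
  signed_iso s t -> signed_iso t r -> signed_iso s r.
Proof.
case/signed_isoP=> f f_iso f_sgn /signed_isoP[g g_iso g_sgn].
have [f_bij f_adj] := graph_isoP _ f_iso.
have [g_bij g_adj] := graph_isoP _ g_iso.
apply/signed_isoP; exists [ffun x => g (f x)].
  apply/graph_isoP; split=> [|x y]; last by rewrite !ffunE g_adj f_adj.
  apply: eq_bij (bij_comp g_bij f_bij) _ _ => x; first by rewrite ffunE.
move=> e e'; rewrite (eq_imset _ (ffunE _)) (imset_comp g f) => e'E.
pose d : edge H := Sub (f @: val e) (imset_edges e f_iso).
by rewrite (g_sgn d) // (f_sgn e).
Qed.

Lemma signed_iso_switching (G H : sgraph) (s s' : signature G)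
    (t : signature H) :
  switching_equivalent s s' -> signed_iso s t ->
  exists2 t', switching_equivalent t t' & signed_iso s' t'.
Proof.
case/connectP=> p; elim: p s t => [|r p IHp] s t /=.
  by move=> _ -> st; exists t => //; apply: connect0.
case/andP=> /existsP[u /eqP->] p_path p_last /signed_isoP[f f_iso f_sgn].
have f_inj : injective f by have [/bij_inj] := graph_isoP _ f_iso.
have [|t' tt' st'] := IHp _ (switch (f u) t) p_path p_last.
  apply/signed_isoP; exists f => // e e' e'E.
  by rewrite !ffunE (f_sgn e) // e'E mem_imset.
exists t' => //; apply: connect_trans tt'.
by apply: connect1; apply/existsP; exists (f u).
Qed.

Lemma switching_isomorphicP (G H : sgraph)
    (s : signature G) (t : signature H) :
  reflect (exists2 t', switching_equivalent t t' & signed_iso s t')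
          (switching_isomorphic s t).
Proof.
apply: (iffP existsP) => [[t' /andP[]]|[t' tt' st']]; exists t' => //.
exact/andP.
Qed.

Lemma switching_isomorphic_equiv (G : sgraph) :
  equivalence_rel (@switching_isomorphic G G).
Proof.
have refl (s : signature G) : switching_isomorphic s s.
  by apply/switching_isomorphicP; exists s; [apply: connect0 | apply: signed_iso_refl].
have sym (s t : signature G) : switching_isomorphic s t -> switching_isomorphic t s.
  case/switching_isomorphicP=> t' tt' st'; apply/switching_isomorphicP.
  rewrite switching_equivalent_sym in tt'.
  exact: signed_iso_switching tt' (signed_iso_sym st').
have trans (s t r : signature G) : switching_isomorphic s t ->
    switching_isomorphic t r -> switching_isomorphic s r.
  case/switching_isomorphicP=> t' tt' st' /switching_isomorphicP[r' rr' tr'].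
  have [r'' r'r'' t'r''] := signed_iso_switching tt' tr'.
  apply/switching_isomorphicP; exists r''; first exact: connect_trans rr' r'r''.
  exact: signed_iso_trans st' t'r''.
move=> s t r; split=> // st; apply/idP/idP; last exact: trans.
exact/trans/sym.
Qed.

Definition num_switching_classes (G : sgraph) : nat :=
  #|equivalence_partition (@switching_isomorphic G G) [set: signature G]|.

Definition psi n := num_switching_classes (wheel n).

(* Main.v *)
Require Import Defs.
From mathcomp Require Import all_boot all_order all_algebra.

(* Switching a signed wheel does not change the signs of its triangles
   [v v_i v_(i+1)], and these determine the signature up to switching.  For
   [n >= 4] the automorphisms of the wheel fix the hub and act on the rim as the
   dihedral group, so the switching isomorphism classes correspond to binary
   bracelets of length [n]; these are counted by enumerating the words that are
   lexicographically least in their dihedral orbit. *)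

Set Implicit Arguments.
Unset Strict Implicit.
Unset Printing Implicit Defensive.

(** * Counting equivalence classes by a complete invariant *)

Lemma card_equivalence_partition (T : finType) (S : eqType) (e : rel T)
    (c : T -> S) (L : seq S) :
  (forall x y, e x y = (c x == c y)) -> uniq L ->
  (forall z, reflect (exists x, c x = z) (z \in L)) ->
  #|equivalence_partition e [set: T]| = size L.
Proof.
(* The blocks are the fibres [F z] of [c]. Those over [L] are nonempty, so distinct values have
   distinct fibres. *)
move=> eE L_uniq LP; pose F z := [set x : T | c x == z].
have F_inj : {in L &, injective F}.
  move=> z1 z2 /LP[x xz1] _ /setP/(_ x).
  by rewrite !inE xz1 eqxx => /esym/eqP.
have FL_uniq : uniq [seq F z | z <- L] by rewrite map_inj_in_uniq.
rewrite -(size_map F L) -(card_uniqP FL_uniq); apply: eq_card => A.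
apply/imsetP/mapP => [[x _ ->]|[z /LP[x xz] ->]].
  exists (c x); first by apply/LP; exists x.
  by apply/setP=> y; rewrite !inE eE eq_sym.
by exists x => //; apply/setP=> y; rewrite !inE eE xz eq_sym.
Qed.

(** * Binary words and their least dihedral images *)

Definition dihedral_words (w : bitseq) : seq bitseq :=
  [seq rot k v | v <- [:: w; rev w], k <- iota 0 (size w).+1].

(** The cast to [seqlexi bool] selects the lexicographic order. Starting the fold at [w] adds
    nothing new, as [w] lies in its own orbit. *)
Definition least_word (w : bitseq) : bitseq :=
  foldr (fun v u : seqlexi bool => Order.min v u) w (dihedral_words w).

Fixpoint bitwords n : seq bitseq :=
  if n is n'.+1
  then [seq b :: w | b <- [:: false; true], w <- bitwords n']
  else [:: [::]].

Lemma mem_bitwords n w : (w \in bitwords n) = (size w == n).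
Proof.
elim: n w => [|n IHn] [|b w]; rewrite ?inE //.
  by apply/allpairsP => -[[b w] []].
rewrite eqSS -IHn; apply/allpairsP/idP => [[[c v] [_ v_in [_ ->]]] //|w_in].
by exists (b, w); split=> //; case: b.
Qed.

Lemma bitwords_uniq n : uniq (bitwords n).
Proof.
elim: n => //= n IHn; rewrite cats0 cat_uniq !map_inj_uniq ?IHn ?andbT /=;
  try by move=> ? ? [].
by apply/hasPn=> _ /mapP[w _ ->]; apply/mapP=> -[].
Qed.

Lemma mem_dihedral_words w : w \in dihedral_words w.
Proof.
(* The range of rotations has [size w + 1] entries, so it contains 0 even when [w] is empty. *)
by apply/allpairsP; exists (w, 0); split; rewrite ?inE ?eqxx ?rot0.
Qed.

Lemma foldr_min_mem d (T : orderType d) (x : T) (r : seq T) :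
  foldr Order.min x r \in x :: r.
Proof.
elim: r => [|y r IHr] /=; first exact: mem_head.
case: Order.TotalTheory.leP => _; first by rewrite !inE eqxx orbT.
by move: IHr; rewrite !inE => /orP[->//|->]; rewrite !orbT.
Qed.

Lemma foldr_min_le d (T : orderType d) (x : T) (r : seq T) y :
  y \in r -> (foldr Order.min x r <= y)%O.
Proof.
elim: r => //= z r IHr; rewrite inE Order.TotalTheory.ge_min.
by case/predU1P=> [->|/IHr->]; rewrite ?Order.POrderTheory.lexx ?orbT.
Qed.

Lemma least_word_mem w : least_word w \in dihedral_words w.
Proof.
have : least_word w \in w :: dihedral_words w.
  exact: (@foldr_min_mem _ (seqlexi bool)).
by rewrite inE => /predU1P[->|//]; apply: mem_dihedral_words.
Qed.

Lemma least_word_le w v :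
  v \in dihedral_words w -> (least_word w <= v :> seqlexi bool)%O.
Proof. exact: (@foldr_min_le _ (seqlexi bool)). Qed.

Lemma eq_least_word w w' :
  dihedral_words w =i dihedral_words w' -> least_word w = least_word w'.
Proof.
move=> eq_ww'; apply: (@Order.POrderTheory.le_anti _ (seqlexi bool)).
apply/andP; split; apply: least_word_le; [rewrite eq_ww' | rewrite -eq_ww'];
  exact: least_word_mem.
Qed.

(** * Dihedral symmetry of functions on the integers modulo [n] *)

Section Bracelets.

Variable m : nat.
Local Notation n := m.+4.
Local Open Scope ring_scope.
Import GRing.Theory.

Implicit Types (h : 'I_n -> bool) (i j k : 'I_n).

Definition word h : bitseq := mkseq (fun a => h a%:R) n.

(** In the ring ['I_n] of residues, rotations and reflections are the affine maps of slope 1 and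
    -1. *)
Definition dihedral h h' : Prop :=
  exists k, (forall i, h' i = h (i + k)) \/ (forall i, h' i = h (k - i)).

Lemma size_word h : size (word h) = n.
Proof. exact: size_mkseq. Qed.

Lemma eq_word h h' : h =1 h' -> word h = word h'.
Proof. by move=> eq_hh'; apply: eq_mkseq => a; apply: eq_hh'. Qed.

Lemma word_inj h h' : word h = word h' -> h =1 h'.
Proof.
move=> eq_hh' i; have := congr1 (nth false ^~ i) eq_hh'.
by rewrite !nth_mkseq // natr_Zp.
Qed.

Lemma word_surj w : size w = n -> exists h, w = word h.
Proof.
move=> w_n; exists (fun i => nth false w i).
apply: (@eq_from_nth _ false); rewrite ?size_word // w_n => a a_lt.
by rewrite nth_mkseq //= Zp_nat /= modn_small.
Qed.

Lemma natr_ord_n : n%:R = 0 :> 'I_n.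
Proof. by apply: val_inj; rewrite Zp_nat /= modnn. Qed.

Lemma rot_word h a :
  (a <= n)%N -> rot a (word h) = word (fun i => h (i + a%:R)).
Proof.
move=> a_n; apply: (@eq_from_nth _ false) => [|b];
  rewrite size_rot !size_word // => b_n.
 rewrite [RHS]nth_mkseq // /rot nth_cat size_drop size_word nth_drop.
rewrite -natrD addnC.
case: ltnP => ba; first by rewrite nth_mkseq // addnC -ltn_subRL.
(* Past the wrap-around the letter sits at position [q] of the prefix moved to the end, and
   [n%:R = 0] identifies the indices [a + b] and [q]. *)
have [q bE] : exists q, (a + b = n + q)%N.
  by exists (a + b - n)%N; rewrite subnKC // -leq_subLR.
have -> : (b - (n - a) = q)%N by rewrite subnBA // addnC bE addKn.
have q_a : (q < a)%N by rewrite -(ltn_add2l n) -bE addnC ltn_add2r.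
rewrite nth_take // nth_mkseq ?(leq_trans q_a) //.
by rewrite addnC bE natrD natr_ord_n add0r.
Qed.

(** Reversal exchanges positions [a] and [n - 1 - a], and [n] vanishes in ['I_n]. *)
Lemma rev_word h : rev (word h) = word (fun i => h (-1 - i)).
Proof.
apply: (@eq_from_nth _ false) => [|a]; rewrite size_rev !size_word // => a_n.
rewrite nth_rev ?size_word // !nth_mkseq ?ltn_subrL //.
by rewrite natrB // natr_ord_n sub0r -natr1 opprD addrC.
Qed.

Lemma dihedral_wordsP h w :
  reflect (exists2 h', dihedral h h' & w = word h')
          (w \in dihedral_words (word h)).
Proof.
apply: (iffP allpairsP) => [[[v a] []]|[h' [k h'E] ->]].
  rewrite mem_iota size_word add0n ltnS !inE.
  case/orP=> /eqP-> a_n ->.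
    exists (fun i => h (i + a%:R)); last exact: rot_word.
    by exists a%:R; left.
  exists (fun i => h (-1 - (i + a%:R))); last by rewrite rev_word rot_word.
  by exists (-1 - a%:R); right=> i; rewrite opprD addrCA addrC.
have le_n j : (j <= n)%N by rewrite ltnW.
case: h'E => h'E.
  exists (word h, val k); rewrite mem_iota size_word ltnS le_n inE eqxx.
  by split=> //=; rewrite rot_word // natr_Zp; apply: eq_word.
(* Rotating the reversed word by [j] reads [h] at [-1 - (i + j)], which is [k - i] for this [j]. *)
have [j jE] : exists j, j = -1 - k by exists (-1 - k).
exists (rev (word h), val j).
rewrite mem_iota size_word ltnS le_n !inE eqxx orbT; split=> //=.
rewrite rev_word rot_word // natr_Zp; apply: eq_word => i.
by rewrite h'E jE addrCA -(opprB k i) subKr.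
Qed.

Lemma dihedral_sym h h' : dihedral h h' -> dihedral h' h.
Proof.
move=> [k [h'E|h'E]]; [exists (- k); left|exists k; right] => i.
  by rewrite h'E subrK.
by rewrite h'E subKr.
Qed.

Lemma dihedral_trans h1 h2 h3 :
  dihedral h1 h2 -> dihedral h2 h3 -> dihedral h1 h3.
Proof.
move=> [k [E|E]] [l [E'|E']].
- by exists (l + k); left=> i; rewrite E' E addrA.
- by exists (l + k); right=> i; rewrite E' E addrAC.
- by exists (k - l); right=> i; rewrite E' E opprD addrCA addrC.
- by exists (k - l); left=> i; rewrite E' E opprB addrCA.
Qed.

(** A common least word lies in both orbits and so links [h] to [h']; conversely, related functions
    have the same orbit and hence the same minimum. *)
Lemma least_wordP h h' :
  reflect (dihedral h h') (least_word (word h) == least_word (word h')).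
Proof.
apply: (iffP eqP) => [eq_l|hh'].
  have /dihedral_wordsP[k hk lE] := least_word_mem (word h).
  have /dihedral_wordsP[k' h'k'] := least_word_mem (word h').
  rewrite -eq_l lE => /word_inj kk'; apply: dihedral_trans hk _.
  case: (dihedral_sym h'k') => l k'l; exists l.
  by case: k'l => k'l; [left|right] => i; rewrite k'l kk'.
apply: eq_least_word => w; apply/dihedral_wordsP/dihedral_wordsP => -[k hk ->].
  by exists k => //; apply: dihedral_trans (dihedral_sym hh') hk.
by exists k => //; apply: dihedral_trans hh' hk.
Qed.

(** Thus, among words of length [n], the values of [least_word] are its fixed points, and
    representatives can be counted by a filter. *)
Lemma least_word_id h : least_word (least_word (word h)) = least_word (word h).
Proof.
have /dihedral_wordsP[k hk lE] := least_word_mem (word h).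
by rewrite {1}lE; apply/esym/eqP/least_wordP.
Qed.

End Bracelets.

(** * Edge signs as functions of endpoints *)

Section EdgeSign.

Variable G : sgraph.
Implicit Types (s t : signature G) (x y u : G).

(* Takes the junk value [false] when [x] and [y] are not adjacent. *)
Definition edge_sign s x y : bool := oapp s false (insub [set x; y]).

Lemma edge_signC s x y : edge_sign s x y = edge_sign s y x.
Proof. by rewrite /edge_sign setUC. Qed.

Lemma edge_signE s (e : edge G) x y :
  val e = [set x; y] -> edge_sign s x y = s e.
Proof. by rewrite /edge_sign => <-; rewrite valK. Qed.

Lemma adj_edge x y : adj x y -> exists e : edge G, val e = [set x; y].
Proof.
move=> xy; have xyE : [set x; y] \in edges G by apply: imset2_f; rewrite ?inE.
by exists (Sub [set x; y] xyE).
Qed.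

Lemma edge_adj (e : edge G) : exists x y, adj x y /\ val e = [set x; y].
Proof.
case: e => e /= /imset2P[x y _]; rewrite inE => /andP[_ xy] ->.
by exists x, y.
Qed.

Lemma edge_sign_inj s t :
  (forall x y, adj x y -> edge_sign s x y = edge_sign t x y) -> s = t.
Proof.
move=> eq_st; apply/ffunP=> e; have [x [y [xy eE]]] := edge_adj e.
by rewrite -!(edge_signE _ eE) eq_st.
Qed.

Lemma edge_sign_switch u s x y :
  adj x y ->
  edge_sign (switch u s) x y = edge_sign s x y (+) ((u == x) || (u == y)).
Proof.
by move=> /adj_edge[e eE]; rewrite !(edge_signE _ eE) ffunE eE !inE.
Qed.

(** Switching successively at the entries of [r] flips an edge once per occurrence of an endpoint,
    so only parities survive. *)
Lemma switching_equivalent_odd s (r : seq G) :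
  exists2 s', switching_equivalent s s' & forall x y, adj x y ->
    edge_sign s' x y =
      edge_sign s x y (+) odd (count_mem x r) (+) odd (count_mem y r).
Proof.
elim: r => [|u r [s' ss' s'E]].
  by exists s => [|x y]; rewrite ?addbF //; apply: connect0.
exists (switch u s').
  by apply: connect_trans ss' (connect1 _); apply/existsP; exists u.
(* The ends of an edge differ, so [u] contributes to at most one of the two counts. *)
move=> x y xy; have xNy : x != y.
  by apply: contraTneq xy => ->; rewrite adj_irr.
rewrite edge_sign_switch // s'E //= !oddD !oddb.
have [->|_] := eqVneq u x.
  by rewrite (negPf xNy); case: edge_sign; do 2!case: odd.
by case: eqP => _; case: edge_sign; do 2!case: odd.
Qed.

End EdgeSign.

Lemma signed_iso_edge_signP (G H : sgraph) (s : signature G) (t : signature H) :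
  reflect (exists2 f : {ffun G -> H}, graph_iso f & forall x y, adj x y ->
             edge_sign t (f x) (f y) = edge_sign s x y)
          (signed_iso s t).
Proof.
apply: (iffP (signed_isoP s t)) => -[f f_iso f_sgn]; exists f => //.
  move=> x y /adj_edge[e eE].
  pose d : edge H := Sub (f @: val e) (imset_edges e f_iso).
  have dE : val d = [set f x; f y].
    by rewrite /= eE imsetU1 imset_set1.
  by rewrite (edge_signE _ dE) (edge_signE _ eE); apply: f_sgn.
move=> e e'; have [x [y [xy eE]]] := edge_adj e.
rewrite {1}eE imsetU1 imset_set1 => e'E.
by rewrite -(edge_signE _ eE) -(edge_signE _ e'E) f_sgn.
Qed.

(** The default [false] agrees with that of [edge_sign], so signs pull back along any map [f]. For
    an isomorphism it is never reached. *)
Definition pullback (G H : sgraph) (f : G -> H) (t : signature H) :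
    signature G :=
  [ffun e : edge G => oapp t false (insub (f @: val e))].

Lemma edge_sign_pullback (G H : sgraph) (f : G -> H) (t : signature H) x y :
  adj x y -> edge_sign (pullback f t) x y = edge_sign t (f x) (f y).
Proof.
move=> /adj_edge[e eE]; rewrite (edge_signE _ eE) ffunE eE.
by rewrite imsetU1 imset_set1.
Qed.

Lemma signed_iso_pullback (G H : sgraph) (f : {ffun G -> H}) (t : signature H) :
  graph_iso f -> signed_iso (pullback f t) t.
Proof.
move=> f_iso; apply/signed_iso_edge_signP; exists f => // x y xy.
by rewrite edge_sign_pullback.
Qed.

(** * Triangles and automorphisms of the signed wheel *)

Section Wheel.

Variable m : nat.
Local Notation n := m.+4.
Local Open Scope ring_scope.
Import GRing.Theory.

Implicit Types (s t : signature (wheel n)) (i j k : 'I_n).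
Implicit Type f : {ffun wheel n -> wheel n}.

Definition spoke s i := edge_sign s (None : wheel n) (Some i).
Definition rim s i := edge_sign s (Some i : wheel n) (Some (i + 1)).
Definition triangle s i := spoke s i (+) spoke s (i + 1) (+) rim s i.

Lemma addr_neq i k : k != 0 -> (i + k == i) = false.
Proof. by move=> k0; rewrite -subr_eq0 addrAC subrr add0r (negPf k0). Qed.

Lemma adj_rim i j :
  @adj (wheel n) (Some i) (Some j) = (j == i + 1) || (i == j + 1).
Proof.
have ordSE k : ordS k = k + 1 by apply: val_inj; rewrite /= modnDmr addn1.
rewrite /= !ordSE; case: eqVneq => //= <-.
by rewrite eq_sym addr_neq.
Qed.

Lemma adj_succ i : @adj (wheel n) (Some i) (Some (i + 1)).
Proof. by rewrite adj_rim eqxx. Qed.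

Lemma rim_signature_eq s t : spoke s =1 spoke t -> rim s =1 rim t -> s = t.
Proof.
rewrite /spoke /rim => eq_spoke eq_rim.
apply: edge_sign_inj => -[i|] [j|] //.
- rewrite adj_rim => /orP[]/eqP->; first by rewrite eq_rim.
  by rewrite edge_signC [RHS]edge_signC eq_rim.
- by rewrite edge_signC [RHS]edge_signC eq_spoke.
Qed.

(** A vertex lies on none or on exactly two of the edges of a triangle, so the flips cancel. *)
Lemma triangle_switch u s : triangle (switch u s) =1 triangle s.
Proof.
move=> i; rewrite /triangle /spoke /rim !edge_sign_switch ?adj_succ //.
case: u => [j|] /=; last first.
  by case: (edge_sign s None _); case: (edge_sign s None _); rewrite ?addbF.
rewrite !(inj_eq Some_inj); case: (eqVneq j i) => [->|_].
  rewrite eq_sym addr_neq //.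
  by do 3!case: edge_sign.
by case: eqP => _; do 3!case: edge_sign.
Qed.

Lemma triangle_switching_equivalent s t :
  switching_equivalent s t -> triangle s =1 triangle t.
Proof.
case/connectP=> p p_path ->.
elim: p s p_path => //= t' p IHp s /andP[/existsP[u /eqP->] p_path] i.
by rewrite -IHp // triangle_switch.
Qed.

Lemma switching_equivalentP s t :
  reflect (triangle s =1 triangle t) (switching_equivalent s t).
Proof.
apply: (iffP idP) => [|eq_st]; first exact: triangle_switching_equivalent.
(* Switching at the rim vertices where the spokes of [s] and [t] differ makes
   all spokes agree; equal triangles then force the rims to agree. *)
pose r : seq (wheel n) :=
  [seq Some i | i <- enum 'I_n & spoke s i (+) spoke t i].
have [s' ss' s'E] := switching_equivalent_odd s r.
have r_None : count_mem (None : wheel n) r = 0%N.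
  by apply/count_memPn/mapP => -[].
have r_Some i : odd (count_mem (Some i : wheel n) r) = spoke s i (+) spoke t i.
  have inj_Some : injective (fun i => Some i : wheel n) by move=> ? ? [].
  have r_uniq : uniq r by rewrite map_inj_uniq // filter_uniq // enum_uniq.
  rewrite count_uniq_mem // oddb mem_map //.
  by rewrite mem_filter mem_enum andbT.
have spokeE : spoke s' =1 spoke t.
  by move=> i; rewrite /spoke s'E // r_None r_Some addbF -/(spoke s i) addKb.
suff -> : t = s' by [].
apply: rim_signature_eq => i; first by rewrite spokeE.
have := eq_st i; rewrite (triangle_switching_equivalent ss') /triangle.
by rewrite !spokeE => /addbI.
Qed.

Lemma wheel_autP f :
  graph_iso f -> f None = None /\ exists k,
    (forall i, f (Some i) = Some (i + k)) \/
    (forall i, f (Some i) = Some (k - i)).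
Proof.
case/graph_isoP=> f_bij f_adj; have f_inj := bij_inj f_bij.
(* The hub is adjacent to every other vertex, whereas a rim vertex [j] is not adjacent to [j + 2]:
   1, 2 and 3 are nonzero modulo [n]. *)
have f_None : f None = None.
  case fN: (f None) => [j|] //; have [f' _ f'K] := f_bij.
  have: ~~ adj (f None) (f (f' (Some (j + 2%:R)))).
    rewrite fN f'K adj_rim (inj_eq (addrI j)) -addrA [j == _]eq_sym.
    by rewrite !addr_neq.
  rewrite f_adj; case E: (f' _) => [x|] //=.
  by move/(congr1 f): E; rewrite f'K fN => -[/eqP]; rewrite addr_neq.
split=> //.
have [g gE] : exists g : 'I_n -> 'I_n, forall i, f (Some i) = Some (g i).
  exists (fun i => odflt 0 (f (Some i))) => i; case E: (f _) => //.
  by move: E; rewrite -f_None => /f_inj.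
have g_inj : injective g.
  move=> i j eq_g; suff /f_inj[] : f (Some i) = f (Some j) by [].
  by rewrite !gE eq_g.
have step i : g (i + 1) - g i = 1 \/ g (i + 1) - g i = -1.
  have := adj_succ i; rewrite -f_adj !gE adj_rim => /orP[]/eqP->.
    by left; rewrite addrC addKr.
  by right; rewrite opprD addrA subrr add0r.
(* Consecutive steps [1] and [-1] would cancel and give [g (i + 2) = g i]. *)
have diff i : g (i + 1) - g i = g 1 - g 0.
  rewrite -[i]natr_Zp; elim: (nat_of_ord i) => [|a IHa]; first by rewrite add0r.
  rewrite -{}IHa -natr1; set j := a%:R.
  have: g (j + 1 + 1) - g (j + 1) + (g (j + 1) - g j) != 0.
    by rewrite addrA subrK subr_eq0 (inj_eq g_inj) -addrA addr_neq.
  by case: (step (j + 1)) (step j) => -> [] -> //; rewrite ?subrr ?addNr ?eqxx.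
(* Constant steps make [g] affine, with slope [g 1 - g 0] equal to 1 or -1. *)
have gE' a : g a%:R = g 0 + (g 1 - g 0) *+ a.
  elim: a => [|a IHa]; first by rewrite addr0.
  by rewrite -natr1 mulrSr addrA -IHa -(diff a%:R) addrC subrK.
exists (g 0); case: (step 0); rewrite add0r => d; [left|right] => i;
  rewrite gE -{1}[i]natr_Zp gE' d ?mulNrn natr_Zp //.
by rewrite addrC.
Qed.

Lemma wheel_rotation_iso k :
  graph_iso ([ffun x => omap (fun i => i + k) x] : {ffun wheel n -> wheel n}).
Proof.
apply/graph_isoP; split=> [|x y].
  exists (omap (fun i => i - k)) => -[i|]; rewrite ffunE //=.
    by rewrite addrK.
  by rewrite subrK.
rewrite !ffunE; case: x y => [i|] [j|] //.
by rewrite !adj_rim !(addrAC _ k) !(inj_eq (addIr k)).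
Qed.

Lemma wheel_reflection_iso k :
  graph_iso ([ffun x => omap (fun i => k - i) x] : {ffun wheel n -> wheel n}).
Proof.
apply/graph_isoP; split=> [|x y].
  by exists (omap (fun i => k - i)) => -[i|]; rewrite ffunE //= subKr.
rewrite !ffunE; case: x y => [i|] [j|] //; rewrite !adj_rim orbC.
have E (a b : 'I_n) : (k - a == k - b + 1) = (b == a + 1).
  by rewrite -addrA (inj_eq (addrI k)) eqr_oppLR opprD opprK eq_sym subr_eq.
by rewrite !E.
Qed.

Lemma triangle_rotation s t f k :
  f None = None -> (forall i, f (Some i) = Some (i + k)) ->
  (forall x y, adj x y -> edge_sign t (f x) (f y) = edge_sign s x y) ->
  forall i, triangle s i = triangle t (i + k).
Proof.
move=> fN fS f_sgn i; rewrite /triangle /spoke /rim.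
by rewrite -!f_sgn ?adj_succ // fN !fS (addrAC i 1).
Qed.

(** The shift by 1 arises because the rim edge from [i] to [i + 1] goes to the one from [k - 1 - i]
    to [k - i], and a triangle is indexed by the first end of its rim edge. *)
Lemma triangle_reflection s t f k :
  f None = None -> (forall i, f (Some i) = Some (k - i)) ->
  (forall x y, adj x y -> edge_sign t (f x) (f y) = edge_sign s x y) ->
  forall i, triangle s i = triangle t (k - 1 - i).
Proof.
move=> fN fS f_sgn i; rewrite /triangle /spoke /rim.
rewrite -!f_sgn ?adj_succ // fN !fS addrAC subrK opprD addrA.
by rewrite (edge_signC _ (Some _ : wheel n)) [X in X (+) _]addbC.
Qed.

Lemma switching_isomorphic_dihedralP s t :
  reflect (dihedral (triangle s) (triangle t)) (switching_isomorphic s t).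
Proof.
apply: (iffP (switching_isomorphicP s t)) => [[t' tt' st']|/dihedral_sym[k st]].
  apply: dihedral_sym; move/switching_equivalentP: tt' => tt'.
  have [f f_iso f_sgn] := signed_iso_edge_signP _ _ st'.
  have [fN [k fS]] := wheel_autP f_iso.
  case: fS => fS; [exists k; left | exists (k - 1); right] => i; rewrite tt'.
    exact: triangle_rotation f_sgn i.
  exact: triangle_reflection f_sgn i.
(* Pulling [t] back along a suitable automorphism gives a signature with the triangles of [s], hence
   switching equivalent to [s]. *)
have [f f_iso f_tri] :
    exists2 f, graph_iso f & triangle (pullback f t) =1 triangle s.
  have f_sgn f : forall x y, adj x y ->
      edge_sign t (f x) (f y) = edge_sign (pullback f t) x y.
    by move=> x y xy; rewrite edge_sign_pullback.
  case: st => sE; eexists; first exact: (wheel_rotation_iso k).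
  - move=> i; rewrite sE; apply: triangle_rotation (f_sgn _) i => [|j];
      by rewrite ffunE.
  (* Reflecting vertices by [k + 1] reflects triangle indices by [k]. *)
  - exact: (wheel_reflection_iso (k + 1)).
  move=> i; rewrite sE -{2}[k](addrK 1).
  by apply: triangle_reflection (f_sgn _) i => [|j]; rewrite ffunE.
(* The switchings leading from the pullback to [s] are carried by [f] to switchings of [t]. *)
apply: signed_iso_switching (signed_iso_pullback t f_iso).
exact/switching_equivalentP.
Qed.

Lemma triangle_surj (h : 'I_n -> bool) : exists s, triangle s =1 h.
Proof.
(* All spokes are positive, so each triangle takes the sign of its rim edge, prescribed by [h]. *)
pose s : signature (wheel n) :=
  [ffun e : edge (wheel n) =>
     [exists i, (val e == [set Some i; Some (i + 1)]) && h i]].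
exists s => i; have spoke0 j : spoke s j = false.
  have [e eE] : exists e : edge (wheel n), val e = [set None; Some j].
    exact: adj_edge.
  rewrite /spoke (edge_signE _ eE) ffunE eE.
  apply/existsP => -[k /andP[/eqP/setP/(_ None)]].
  by rewrite !inE.
have [e eE] := adj_edge (adj_succ i).
rewrite /triangle !spoke0 /rim (edge_signE _ eE) ffunE eE.
apply/existsP/idP => [[j /andP[/eqP/setP ij hj]]|hi]; last first.
  by exists i; rewrite eqxx.
(* Equal rim edges have equal indices: otherwise [j = i + 1] and [i = j + 1], forcing 2 to vanish
   modulo [n]. *)
have := ij (Some i); have := ij (Some (i + 1)).
rewrite !inE !eqxx orbT !(inj_eq Some_inj) (inj_eq (addIr 1)) [RHS]orbC.
case: eqVneq => [->//|_] /=.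
by move=> /esym/eqP <-; rewrite -addrA eq_sym !addr_neq.
Qed.

(** The least word of the triangle signs is a complete invariant, and every fixed word of length [n]
    is attained because triangle signs are arbitrary. *)
Lemma psi_least_words :
  psi n = size [seq w <- bitwords n | least_word w == w].
Proof.
pose canon s := least_word (word (triangle s)).
apply: (@card_equivalence_partition _ _ _ canon).
- by move=> s t; apply/switching_isomorphic_dihedralP/least_wordP.
- exact/filter_uniq/bitwords_uniq.
move=> z; rewrite mem_filter mem_bitwords.
apply: (iffP andP) => [[/eqP z_least /eqP/word_surj[h zE]]|[s <-]].
  have [s sE] := triangle_surj h; exists s.
  by rewrite /canon (eq_word sE) -zE.
rewrite /canon least_word_id; split=> //.
have /dihedral_wordsP[h _ ->] := least_word_mem (word (triangle s)).
by rewrite size_word.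
Qed.

End Wheel.

Theorem theorem4p1 :
  psi 4 = 6 /\ psi 5 = 8 /\ psi 6 = 13 /\ psi 7 = 18 /\ psi 8 = 30 /\
  psi 9 = 46 /\ psi 10 = 78.
(* Each length has the form [m.+4], and evaluation enumerates the bracelets. *)
Proof. by rewrite !psi_least_words; vm_compute. Qed.
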